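(* Let $\mathcal{P}_4$ be the family of planar graphs having girth at least $4$. The second player has a winning strategy in the game $BS_2(\mathcal{P}_4 : p, q)$ for all integers $p, q \geq 3$.
   Context: The girth of a graph is the length of a shortest cycle (infinite if there is no cycle); a pair of parallel edges counts as a cycle of length 2. The game $BS_2(\mathcal{P}_4:p,q)$ ($2$-Brussels sprout for $\mathcal{P}_4$) is the following two-player game, drawn in the plane. Initially there are two spots (vertices), having $p$ and $q$ open tips (short free partial edges) coming out of them, respectively. The players move alternately. A valid move consists of joining two distinct open tips by a curve that crosses neither itself nor any previously drawn curve, and then drawing a crossbar on this curve: the intersection of the crossbar with the curve is a new vertex, which has two new open tips, one on each side of the curve. The two joined tips are no longer open. The associated graph has as vertices the spots and the curve/crossbar intersections, and as edges the curve pieces joining two such vertices (so each move adds one vertex and two edges); it must belong to $\mathcal{P}_4$ at all times. The first player unable to make a valid move loses. *)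

(* Defs.v *)
(* Mathematical Components *)
From mathcomp Require Import all_boot.

Set Implicit Arguments.
Unset Strict Implicit.
Unset Printing Implicit Defensive.

(* Finite multigraphs on the vertex set {0, ..., nverts - 1}.  The edges form
   a list, so parallel edges are distinct positions of the list; the pair
   (x, y) stands for an undirected edge. *)
Record multigraph := Multigraph { nverts : nat; edges : seq (nat * nat) }.

Definition joins (e : nat * nat) (x y : nat) : bool :=
  (e == (x, y)) || (e == (y, x)).

(* [vs] lists the vertices of the cycle in cyclic order, and [es] the positions
   in [edges g] of its edges, the i-th one joining the i-th vertex to the next.
   A loop is a cycle of length 1, and a pair of parallel edges is a cycle of
   length 2 (uniq es is what excludes going back along the same edge). *)
Definition is_cycle (g : multigraph) (vs es : seq nat) : bool :=
  [&& 0 < size vs, size es == size vs, uniq vs, uniq es &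
      all (fun i => (nth 0 es i < size (edges g)) &&
                    joins (nth (0, 0) (edges g) (nth 0 es i))
                          (nth 0 vs i) (nth 0 (rot 1 vs) i))
          (iota 0 (size vs))].

(* "The girth of g is at least k", acyclic graphs having infinite girth. *)
Definition girth_at_least (k : nat) (g : multigraph) : Prop :=
  forall vs es, is_cycle g vs es -> k <= size vs.

(* Drawings in the plane, up to homeomorphism.  A drawing divides the plane
   into regions.  The boundary of a region has finitely many connected
   components; each is recorded by the open tips met when walking once along it
   with the region on the left.  A tip is represented by the vertex it comes
   out of (so distinct tips of the same vertex are distinct occurrences).
   A boundary matters only up to rotation, and the orders of the boundaries of
   a region and of the regions of a drawing are irrelevant. *)
Definition boundary := seq nat.
Definition region := seq boundary.
Record drawing := Drawing { graph : multigraph; regions : seq region }.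

(* [curve x y mid rs rs']: inside one of the regions rs, a tip of x is joined to
   another tip, of y, by a simple curve meeting nothing else; the two tips are
   used up, and the new open tips [mid] appear on each side of the curve.
   - Tips on the same boundary component b: the region is cut in two.  The tips
     of b strictly between the two ends go to one side (s) or the other (t), and
     each other boundary component of the region ends up on either side (B, C),
     according to how the curve is drawn.
   - Tips on different boundary components b and c: these are merged. *)
Inductive curve (x y : nat) (mid : seq nat) (rs : seq region) :
    seq region -> Prop :=
| CurveSplit i (b : boundary) (s t : seq nat) (R B C : region) rest :
    perm_eq rs (R :: rest) -> perm_eq R (b :: B ++ C) ->
    rot i b = x :: s ++ y :: t ->
    curve x y mid rs (((s ++ mid) :: B) :: ((t ++ mid) :: C) :: rest)
| CurveMerge i j (b c : boundary) (s t : seq nat) (R B : region) rest :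
    perm_eq rs (R :: rest) -> perm_eq R (b :: c :: B) ->
    rot i b = x :: s -> rot j c = y :: t ->
    curve x y mid rs (((s ++ mid ++ t ++ mid) :: B) :: rest).

(* A new vertex with k open tips, placed in some region. *)
Inductive add_spot (k : nat) (d : drawing) : drawing -> Prop :=
| AddSpot (R : region) rest :
    let n := nverts (graph d) in
    perm_eq (regions d) (R :: rest) ->
    add_spot k d (Drawing (Multigraph n.+1 (edges (graph d)))
                          (rcons R (nseq k n) :: rest)).

(* A plain edge joining two tips. *)
Inductive add_edge (d : drawing) : drawing -> Prop :=
| AddEdge x y rs' :
    curve x y [::] (regions d) rs' ->
    add_edge d (Drawing (Multigraph (nverts (graph d))
                                    ((x, y) :: edges (graph d))) rs').

(* A curve joining two tips, with a crossbar: the intersection is a new vertex n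
   having one open tip on each side of the curve. *)
Inductive add_crossed_curve (d : drawing) : drawing -> Prop :=
| AddCrossedCurve x y rs' :
    let n := nverts (graph d) in
    curve x y [:: n] (regions d) rs' ->
    add_crossed_curve d
      (Drawing (Multigraph n.+1 [:: (x, n), (n, y) & edges (graph d)]) rs').

(* The drawings obtained from the empty plane (one region, without boundary) by
   adding spots and non-crossing curves one at a time. *)
Inductive plane_drawing : drawing -> Prop :=
| PlaneEmpty : plane_drawing (Drawing (Multigraph 0 [::]) [:: [::]])
| PlaneSpot k d d' : plane_drawing d -> add_spot k d d' -> plane_drawing d'
| PlaneEdge d d' : plane_drawing d -> add_edge d d' -> plane_drawing d'
| PlaneCrossed d d' :
    plane_drawing d -> add_crossed_curve d d' -> plane_drawing d'.

(* A graph embedded in the plane is redrawn by placing each vertex x with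
   deg x tips, and then its edges one by one, whence all planar multigraphs
   satisfy this. *)
Definition planar (g : multigraph) : Prop :=
  exists d, plane_drawing d /\ graph d = g.

Definition P4 (g : multigraph) : Prop := planar g /\ girth_at_least 4 g.

(* The game BS_2(F : p, q). *)
Definition BS2_start (p q : nat) : drawing :=
  Drawing (Multigraph 2 [::]) [:: [:: nseq p 0; nseq q 1]].

Definition BS2_move (F : multigraph -> Prop) (d d' : drawing) : Prop :=
  add_crossed_curve d d' /\ F (graph d').

(* Two-player games where a player unable to move loses.  [wins_with sigma x]:
   when the first player is to move at x and the second player answers every
   move to y by moving to [sigma y], this answer is always legal and every play
   ends, necessarily with the first player unable to move. *)
Inductive wins_with (T : Type) (move : T -> T -> Prop) (sigma : T -> T) :
    T -> Prop :=
| WinsWith x :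
    (forall y, move x y -> move y (sigma y)) ->
    (forall y, move x y -> wins_with move sigma (sigma y)) ->
    wins_with move sigma x.

Definition second_player_has_winning_strategy
    (T : Type) (move : T -> T -> Prop) (start : T) : Prop :=
  exists sigma : T -> T, wins_with move sigma start.

(* Main.v *)
(* A move joining tips of x and y keeps the girth at least 4 iff x and y are
   distinct and non-adjacent.  The first move has to join the two spots; write 2
   for its new vertex.  The second player joins the spots x and y again, along a
   curve leaving the remaining tips of x on one side and those of y on the other.
   With 3 the new vertex, this gives the regions 2 x^(p-2) 3 and 2 y^(q-2) 3,
   where p - 2 and q - 2 are positive.  In the region 2 x^a 3 with a > 0 the only
   legal move joins 2 and 3, which isolates one tip of the new vertex n on one
   side and leaves x^a n on the other; there, n and x are not adjacent and may be
   joined, after which nothing is possible.  Hence exactly two moves will be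
   played in each of the two regions, whatever the players do, and the second
   player makes the last one. *)
Require Import Defs.
From mathcomp Require Import all_boot.
From Stdlib Require Import ClassicalEpsilon.
From mathcomp Require Import zify.

Set Implicit Arguments.
Unset Strict Implicit.
Unset Printing Implicit Defensive.

(** * Winning strategies from an invariant set of positions *)

(** [epsilon] turns the answers into a function of the position. As [mu] drops with each pair of
    moves, play ends in [S] with the first player to move. *)
Lemma strategy_of_kernel (T : Type) (move : T -> T -> Prop) (S : T -> Prop)
    (mu : T -> nat) (x0 : T) :
  (forall x y, S x -> move x y -> exists z, move y z /\ S z) ->
  (forall x y z, S x -> move x y -> move y z -> S z -> mu z < mu x) ->
  S x0 -> second_player_has_winning_strategy move x0.
Proof.
move=> answer decr Sx0.
pose sigma y := epsilon (inhabits y) (fun z => move y z /\ S z).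
have sigmaP x y : S x -> move x y -> move y (sigma y) /\ S (sigma y).
  by move=> Sx mxy; exact: (epsilon_spec _ _ (answer _ _ Sx mxy)).
exists sigma; have [m] := ubnP (mu x0).
elim: m x0 Sx0 => [|m IHm] x Sx; first by rewrite ltn0.
move=> le_xm; constructor=> y mxy; have [myz Sz] := sigmaP _ _ Sx mxy; first exact: myz.
by apply: (IHm _ Sz); apply: leq_trans (decr _ _ _ Sx mxy myz Sz) _.
Qed.

(** * Girth at least 4 as a local condition, and the legal moves *)

Definition adj (g : multigraph) (x y : nat) : bool :=
  has (fun e => joins e x y) (edges g).

Definition live (g : multigraph) (x y : nat) : bool := (x != y) && ~~ adj g x y.

Definition subdivided_join (g : multigraph) (x y : nat) : multigraph :=
  let n := nverts g in Multigraph n.+1 [:: (x, n), (n, y) & edges g].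

(** Girth at least 4 in terms of adjacency; the bound on edge ends makes the next vertex [nverts g]
    fresh. *)
Definition simple_triangle_free (g : multigraph) : Prop :=
  [/\ forall x y, adj g x y -> x < nverts g /\ y < nverts g,
      forall x, ~~ adj g x x,
      pairwise (fun e f => ~~ joins e f.1 f.2) (edges g) &
      forall x y z, adj g x y -> adj g y z -> ~~ adj g z x].

Lemma joinsC e x y : joins e x y = joins e y x.
Proof. exact: orbC. Qed.

Lemma adjC g x y : adj g x y = adj g y x.
Proof. by apply: eq_has => e; apply: joinsC. Qed.

Lemma liveC g x y : live g x y = live g y x.
Proof. by rewrite /live eq_sym adjC. Qed.

Lemma joinsE a b x y :
  joins (a, b) x y = (a == x) && (b == y) || (a == y) && (b == x).
Proof. by []. Qed.

Lemma adj_nth g x y i :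
  i < size (edges g) -> joins (nth (0, 0) (edges g) i) x y -> adj g x y.
Proof. by move=> lti Ji; apply/hasP; exists (nth (0, 0) (edges g) i); rewrite ?mem_nth. Qed.

Lemma joins2 e f x y : joins e x y -> joins f x y -> joins e f.1 f.2.
Proof.
case: e f => a b [c d]; rewrite !joinsE /=.
by case/orP=> /andP[/eqP-> /eqP->] /orP[] /andP[/eqP-> /eqP->]; rewrite !eqxx ?orbT.
Qed.

(** Only lengths 1, 2 and 3 survive the case analysis: a loop, two parallel edges, a triangle. *)
Lemma simple_triangle_free_girth g : simple_triangle_free g -> girth_at_least 4 g.
Proof.
case=> _ noloop simple notriangle.
move=> [|a [|b [|c [|d vs]]]] [|i [|j [|k [|l es]]]] //; rewrite /is_cycle //=.
- rewrite !andbT => /andP[lti Ji].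
  by have := noloop a; rewrite (adj_nth lti Ji).
- rewrite !andbT !inE => /and4P[_ neq_ij /andP[lti Ji] /andP[ltj Jj]].
  move: neq_ij; rewrite joinsC in Jj.
  have {}simple := pairwiseP (0, 0) simple.
  case: (ltngtP i j) => [lt_ij|lt_ji|//] _.
    by have := simple _ _ lti ltj lt_ij; rewrite (joins2 Ji Jj).
  by have := simple _ _ ltj lti lt_ji; rewrite (joins2 Jj Ji).
- rewrite !andbT => /and5P[_ _ /andP[lti Ji] /andP[ltj Jj] /andP[ltk Jk]].
  have := notriangle a b c (adj_nth lti Ji) (adj_nth ltj Jj).
  by rewrite (adj_nth ltk Jk).
Qed.

Lemma adj_subdivided_join g x y a b :
  adj (subdivided_join g x y) a b =
  [|| joins (x, nverts g) a b, joins (nverts g, y) a b | adj g a b].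
Proof. by []. Qed.

(** Joining [x] to itself creates a cycle of length 2 through the new vertex; joining adjacent
    vertices creates a triangle. *)
Lemma girth4_live g x y :
    x < nverts g -> y < nverts g ->
  girth_at_least 4 (subdivided_join g x y) -> live g x y.
Proof.
move=> ltx lty girth; have neq_xy : x != y.
  apply/eqP=> eq_xy; subst y.
  suff: is_cycle (subdivided_join g x x) [:: x; nverts g] [:: 0; 1] by move/girth.
  by rewrite /is_cycle /= !inE /joins !eqxx /= !andbT (ltn_eqF ltx).
rewrite /live neq_xy; apply/negP=> /hasP[e e_g Je].
(* The two new edges head the list and shift the position of the old edge by 2. *)
suff: is_cycle (subdivided_join g x y) [:: x; nverts g; y]
        [:: 0; 1; (index e (edges g)).+2] by move/girth.
rewrite /is_cycle /= !inE !ltnS index_mem e_g nth_index // [joins e y x]joinsC Je.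
by rewrite /joins !eqxx /= !andbT negb_or (ltn_eqF ltx) neq_xy (gtn_eqF lty).
Qed.

(** The new vertex has only [x] and [y] as neighbours, and these are not adjacent, so no triangle
    passes through it. *)
Lemma simple_triangle_free_join g x y :
    simple_triangle_free g -> x < nverts g -> y < nverts g -> live g x y ->
  simple_triangle_free (subdivided_join g x y).
Proof.
case=> bound noloop simple notriangle ltx lty /andP[neq_xy nadj_xy].
set n := nverts g.
have nadj_n a : ~~ adj g n a by apply/negP=> /bound[]; rewrite ltnn.
split.
- move=> a b; rewrite adj_subdivided_join !joinsE -/n /=.
  by case/or3P=> [||/bound]; rewrite -/n; lia.
- move=> a; rewrite adj_subdivided_join !joinsE -/n (negPf (noloop a)).
  lia.
- have lt_e e1 e2 : (e1, e2) \in edges g -> e1 < n /\ e2 < n.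
    by move=> e_g; apply: bound; apply/hasP; exists (e1, e2); rewrite // joinsE !eqxx.
  rewrite /= simple andbT joinsE /= -/n -andbA; apply/and3P; split; first by lia.
    by apply/allP=> -[e1 e2] /lt_e[]; rewrite joinsE /=; lia.
  by apply/allP=> -[e1 e2] /lt_e[]; rewrite joinsE /=; lia.
have adjE a b : adj (subdivided_join g x y) a b ->
    [\/ a = n /\ (b = x \/ b = y), b = n /\ (a = x \/ a = y) | adj g a b].
  rewrite adj_subdivided_join !joinsE -/n => /or3P[||]; last by constructor 3.
    by case/orP=> /andP[/eqP<- /eqP<-]; [constructor 2 | constructor 1]; auto.
  by case/orP=> /andP[/eqP<- /eqP<-]; [constructor 1 | constructor 2]; auto.
have nadj_xx := noloop x; have nadj_yy := noloop y.
have nadj_yx : ~~ adj g y x by rewrite adjC.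
have nadj_n' a : ~~ adj g a n by rewrite adjC.
have key a b : (a = x \/ a = y) -> (b = x \/ b = y) -> ~~ adj g a b.
  by move=> [->|->] [->|->].
have nx : ~ (n = x \/ n = y) by rewrite /n; lia.
move=> a b c /adjE ab /adjE bc; apply/negP=> /adjE ca.
have F d : adj g n d -> False by apply/negP.
have F' d : adj g d n -> False by apply/negP.
have K d e : (d = x \/ d = y) -> (e = x \/ e = y) -> adj g d e -> False.
  by move=> hd he; apply/negP/key.
have [an|an] := eqVneq a n.
  subst a; case: ab => [[_ b_xy]|[bn]|/F//]; last by case/nx.
  case: ca => [[cn]|[_ c_xy]|/F'//]; first by case/nx.
  case: bc => [[bn]|[cn]|]; last exact: K.
    by move: b_xy; rewrite bn => /nx.
  by move: c_xy; rewrite cn => /nx.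
have [bn|bn] := eqVneq b n.
  subst b; case: bc => [[_ c_xy]|[cn]|/F//]; last by case/nx.
  case: ab => [[/eqP]|[_ a_xy]|/F'//]; first by rewrite (negPf an).
  case: ca => [[cn]|[/eqP]|]; last exact: K.
    by move: c_xy; rewrite cn => /nx.
  by rewrite (negPf an).
have [cn|cn] := eqVneq c n.
  subst c; case: ca => [[_ a_xy]|[/eqP]|/F//]; last by rewrite (negPf an).
  case: bc => [[/eqP]|[_ b_xy]|/F'//]; first by rewrite (negPf bn).
  case: ab => [[/eqP]|[/eqP]|]; last exact: K.
    by rewrite (negPf an).
  by rewrite (negPf bn).
case: ab => [[/eqP]|[/eqP]|ab]; rewrite ?(negPf an) ?(negPf bn) //.
case: bc => [[/eqP]|[/eqP]|bc]; rewrite ?(negPf bn) ?(negPf cn) //.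
case: ca => [[/eqP]|[/eqP]|ca]; rewrite ?(negPf an) ?(negPf cn) //.
by have := notriangle a b c ab bc; rewrite ca.
Qed.

(** * Ranks of regions, and their persistence when a move is made elsewhere *)

Lemma live_subdivided_join g x y a b :
    a < nverts g -> b < nverts g ->
  live (subdivided_join g x y) a b = live g a b.
Proof.
move=> lta ltb; rewrite /live adj_subdivided_join !joinsE.
by rewrite !(gtn_eqF lta, gtn_eqF ltb) !andbF.
Qed.

(* Rank k: every play inside the region lasts exactly k moves. *)
Inductive region_rank (g : multigraph) : region -> nat -> Prop :=
| RankDead (b : boundary) :
    {in b &, forall x y, ~~ live g x y} -> region_rank g [:: b] 0
| RankOne (b : boundary) u w a :
    0 < a -> live g u w -> perm_eq b (u :: nseq a w) -> region_rank g [:: b] 1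
| RankTwo (b : boundary) i u v w a :
    0 < a -> live g u v -> adj g u w -> adj g v w ->
    rot i b = [:: u, v & nseq a w] -> region_rank g [:: b] 2.

(** Ranks add up because regions do not interact: new edges all meet the new vertex, and the bound
    says that the present tips belong to older vertices. *)
Inductive ranked (g : multigraph) : seq region -> nat -> Prop :=
| RankedNil : ranked g [::] 0
| RankedCons R rs k l :
    all (gtn (nverts g)) (flatten R) -> region_rank g R k -> ranked g rs l ->
    ranked g (R :: rs) (k + l).

Lemma ranked_rem g rs k R :
  ranked g rs k -> R \in rs ->
  exists k1 k2, [/\ all (gtn (nverts g)) (flatten R), region_rank g R k1,
                    ranked g (rem R rs) k2 & k = k1 + k2].
Proof.
elim=> // {rs k} R' rs k l ltR rR rs_l IH.
rewrite inE /=; have [eq_R|_] := eqVneq R' R; first by subst R'; exists k, l.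
move=> /IH[k1 [k2 [h1 h2 h3 ->]]].
by exists k1, (k + k2); split=> //; [apply: RankedCons | lia].
Qed.

Lemma ranked_perm g rs rs' k : perm_eq rs rs' -> ranked g rs k -> ranked g rs' k.
Proof.
elim: rs' rs k => [|R rs' IH] rs k; first by move/perm_nilP->.
move=> eq_rs rk; have R_rs : R \in rs by rewrite (perm_mem eq_rs) mem_head.
have [k1 [k2 [h1 h2 h3 ->]]] := ranked_rem rk R_rs; apply: RankedCons => //.
apply: IH h3; rewrite -(perm_cons R).
by apply: perm_trans eq_rs; rewrite perm_sym perm_to_rem.
Qed.

Lemma ranked_consP g R rs k :
  ranked g (R :: rs) k ->
  exists k1 k2, [/\ all (gtn (nverts g)) (flatten R), region_rank g R k1,
                    ranked g rs k2 & k = k1 + k2].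
Proof. by move/ranked_rem/(_ (mem_head _ _)); rewrite /= eqxx. Qed.

Lemma region_rank_join g x y R k :
    all (gtn (nverts g)) (flatten R) -> region_rank g R k ->
  region_rank (subdivided_join g x y) R k.
Proof.
move=> ltR rR; case: rR ltR => {R k}.
- move=> b dead; rewrite /= cats0 => /allP ltb; apply: RankDead => u v ub vb.
  by rewrite live_subdivided_join ?dead //; apply: ltb.
- move=> b u w a a_gt0 uw eq_b; rewrite /= cats0 (perm_all _ eq_b) /= => /andP[ltu].
  (* As [a] is positive, [w] does occur on the boundary, hence is an old vertex. *)
  rewrite all_nseq (gtn_eqF a_gt0) /= => ltw.
  by apply: (@RankOne _ b u w a) => //; rewrite live_subdivided_join.
- move=> b i u v w a a_gt0 uv uw vw eq_b; rewrite /= cats0 => ltb.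
  have := ltb; rewrite -(eq_all_r (mem_rot i b)) eq_b /= => /and3P[ltu ltv _].
  apply: (@RankTwo _ b i u v w a) => //; rewrite ?live_subdivided_join //.
    by rewrite adj_subdivided_join uw !orbT.
  by rewrite adj_subdivided_join vw !orbT.
Qed.

Lemma ranked_join g x y rs k :
  ranked g rs k -> ranked (subdivided_join g x y) rs k.
Proof.
elim=> [|{}rs R k' l ltR rR _ IH]; first exact: RankedNil.
apply: RankedCons => //; last exact: region_rank_join.
by apply: sub_all ltR => i; apply: ltnW.
Qed.

(** * Cyclic words with one or two distinguished letters *)

Lemma perm_eq_singleton (T : eqType) (x y : T) (s : seq T) :
  perm_eq [:: x] (y :: s) -> y = x /\ s = [::].
Proof.
by rewrite perm_sym => /(perm_small_eq (isT : size [:: x] <= 1))[-> ->].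
Qed.

Lemma perm_eq_split (T : eqType) (x y u w : T) a (r : seq T) :
    x != y -> perm_eq [:: x, y & r] (u :: nseq a w) ->
  (x = u /\ y = w \/ x = w /\ y = u) /\ all (pred1 w) r.
Proof.
have all_w r' : perm_eq r' (nseq a w) -> all (pred1 w) r'.
  by move/perm_all->; apply: all_pred1_nseq.
move=> neq_xy eq_r; have [eq_xu|neq_xu] := eqVneq x u.
  by subst u; move: eq_r; rewrite perm_cons => /all_w/andP[/eqP-> r_w]; split; auto.
have := perm_mem eq_r x; rewrite !inE eqxx (negPf neq_xu) mem_nseq /=.
case/esym/andP=> a_gt0 /eqP eq_xw; subst w.
have := perm_mem eq_r y; rewrite !inE eqxx orbT mem_nseq eq_sym in neq_xy *.
rewrite (negPf neq_xy) andbF orbF => /esym/eqP eq_yu; subst u; split; first by auto.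
move: eq_r; rewrite -(perm_rot 1) rot1_cons /= perm_cons -cats1.
by rewrite perm_catC /= => /all_w/andP[].
Qed.

(** Rotations are invertible and compose; this compares the cut made by a move with the normal form
    of a boundary. *)
Lemma rot_trans (T : Type) (i j : nat) (s : seq T) :
  exists l, rot i s = rot l (rot j s).
Proof.
have [le_i|/ltnW le_i] := leqP i (size s); last first.
  by rewrite rot_oversize //; exists (size (rot j s) - j); apply/esym/rotK.
exists (if i + (size s - j) <= size s then i + (size s - j)
        else i + (size s - j) - size s).
rewrite -{1}(rotK j s) /rotr size_rot.
by rewrite rot_add_mod ?size_rot ?leq_subr.
Qed.

(** Letters other than [w] occur only at the first two places, so cutting at both leaves the block
    of [w] in one piece. *)
Lemma rot_cons2_nseq (T : eqType) (x y u v w : T) a i (s t : seq T) :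
    x != w -> y != w -> rot i [:: u, v & nseq a w] = x :: s ++ y :: t ->
  [/\ x = u, y = v, s = [::] & t = nseq a w] \/
  [/\ x = v, y = u, s = nseq a w & t = [::]].
Proof.
move=> xw yw.
have not_nseq n s1 s2 : nseq n w = s1 ++ y :: s2 -> False.
  move=> eq_n; have : y \in nseq n w by rewrite eq_n mem_cat mem_head orbT.
  by rewrite mem_nseq (negPf yw) andbF.
have cons_cut z n s1 s2 : z :: nseq n w = s1 ++ y :: s2 ->
    [/\ y = z, s1 = [::] & s2 = nseq n w].
  by case: s1 => [[-> ->]//|z' s1 [_ /not_nseq]].
have cut_rcons z n s1 s2 : rcons (nseq n w) z = s1 ++ y :: s2 ->
    [/\ y = z, s1 = nseq n w & s2 = [::]].
  case/lastP: s2 => [|s2 z']; first by rewrite cats1 => /rcons_inj[-> ->].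
  by rewrite -rcons_cons -rcons_cat => /rcons_inj[/not_nseq].
have id_case : [:: u, v & nseq a w] = x :: s ++ y :: t ->
    [/\ x = u, y = v, s = [::] & t = nseq a w] by case=> -> /cons_cut[].
case: i => [|[|i]]; first by rewrite rot0 => /id_case; left.
  by rewrite rot1_cons /= => -[-> /cut_rcons[]]; right.
(* Any other rotation is the identity or starts inside the block of [w]. *)
have [|lt_ia] := leqP (size [:: u, v & nseq a w]) i.+2.
  by move=> ?; rewrite rot_oversize // => /id_case; left.
rewrite /rot /= => eq_r; case/eqP: xw.
have : x \in nseq a w.
  rewrite -(cat_take_drop i (nseq a w)) mem_cat; apply/orP; right.
  move: lt_ia eq_r; rewrite /= !ltnS -subn_gt0 -size_drop.
  by case: (drop i _) => //= z r _ [-> _]; apply: mem_head.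
by rewrite mem_nseq => /andP[_ /eqP].
Qed.

Lemma all_rot_cons2 (n : nat) b i x s y t :
    all (gtn n) b -> rot i b = x :: s ++ y :: t ->
  [&& x < n, all (gtn n) s, y < n & all (gtn n) t].
Proof.
move=> ltb eq_b; move: ltb; rewrite -(eq_all_r (mem_rot i b)) eq_b.
by rewrite /= all_cat /= => /and4P[-> -> ->].
Qed.

(** * The effect of a legal move on the rank of its region *)

(** The tips left are copies of [w] and one tip of the new vertex, which is adjacent to [w]. *)
Lemma region_rank_dead_join g x y w s :
    w = x \/ w = y -> all (pred1 w) s ->
  region_rank (subdivided_join g x y) [:: s ++ [:: nverts g]] 0.
Proof.
move=> w_xy /all_pred1P->; apply: RankDead.
suff n_w : adj (subdivided_join g x y) (nverts g) w.
  move=> u v; rewrite !mem_cat !mem_nseq !inE /live.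
  case/orP=> [/andP[_ /eqP->]|/eqP->] /orP[/andP[_ /eqP->]|/eqP->];
    by rewrite ?eqxx // adjC ?n_w ?andbF // adjC n_w andbF.
by rewrite adj_subdivided_join !joinsE; case: w_xy => ->; rewrite !eqxx ?orbT.
Qed.

Lemma live_new_vertex g x y w :
    simple_triangle_free g -> w < nverts g -> w != x -> w != y ->
  live (subdivided_join g x y) (nverts g) w.
Proof.
case=> bound _ _ _ ltw wx wy; rewrite /live adj_subdivided_join !joinsE.
have nadj : ~~ adj g (nverts g) w by apply/negP=> /bound[]; rewrite ltnn.
by rewrite (negPf nadj); lia.
Qed.

(** A legal move uses up exactly one unit of rank. In rank 1 it joins [u] to a copy of [w], and both
    pieces are dead. In rank 2 it joins [u] and [v]; one piece has only a tip of the new vertex, and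
    the other, with all copies of [w], has rank 1. *)
Lemma region_rank_split g R k b B i x s y t :
    simple_triangle_free g -> all (gtn (nverts g)) (flatten R) ->
    region_rank g R k -> live g x y -> perm_eq R (b :: B) ->
    rot i b = x :: s ++ y :: t ->
  B = [::] /\ exists k1 k2,
    [/\ region_rank (subdivided_join g x y) [:: s ++ [:: nverts g]] k1,
        region_rank (subdivided_join g x y) [:: t ++ [:: nverts g]] k2 &
        k = (k1 + k2).+1].
Proof.
move=> Gg ltR rR; case: rR ltR => {R k} => [b'|b' u w a|b' j u v w a];
  rewrite /= cats0.
- move=> dead _ xy /perm_eq_singleton[] -> -> eq_b.
  suff: ~~ live g x y by rewrite xy.
  apply: dead.
    by rewrite -(mem_rot i) eq_b mem_head.
  by rewrite -(mem_rot i) eq_b inE mem_cat mem_head !orbT.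
- move=> a_gt0 uw perm_b ltb xy /perm_eq_singleton[] -> -> eq_b; split=> //.
  have [neq_xy _] := andP xy.
  have /(perm_eq_split neq_xy)[xy_uw] : perm_eq [:: x, y & s ++ t] (u :: nseq a w).
    rewrite -(permPr perm_b) perm_sym -(perm_rot i b') eq_b perm_cons.
    by rewrite perm_catC /= perm_cons perm_catC.
  rewrite all_cat => /andP[sw tw]; exists 0, 0.
  have w_xy : w = x \/ w = y by case: xy_uw => -[-> ->]; auto.
  by split=> //; apply: (region_rank_dead_join _ w_xy).
- move=> a_gt0 uv uw vw eq_b' ltb xy /perm_eq_singleton[] -> -> eq_b; split=> //.
  have [bound noloop _ _] := Gg.
  have [_ ltw] := bound _ _ uw.
  have neq_uw : u != w by apply: contraNneq (noloop w) => {1}<-.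
  have neq_vw : v != w by apply: contraNneq (noloop w) => {1}<-.
  (* Every tip on the boundary is equal or adjacent to [w], so a legal curve avoids [w]. *)
  have nlw z : z \in b' -> ~~ live g z w.
    rewrite -(mem_rot j) eq_b' !inE mem_nseq /live => /or3P[/eqP->|/eqP->|/andP[_ /eqP->]].
    - by rewrite uw andbF.
    - by rewrite vw andbF.
    by rewrite eqxx.
  have xw : x != w.
    apply: contraTneq xy => ->; rewrite liveC; apply: nlw.
    by rewrite -(mem_rot i) eq_b inE mem_cat mem_head !orbT.
  have yw : y != w.
    apply: contraTneq xy => ->; apply: nlw.
    by rewrite -(mem_rot i) eq_b mem_head.
  have [l eq_l] : exists l, rot l [:: u, v & nseq a w] = x :: s ++ y :: t.
    by rewrite -eq_b -eq_b'; have [l ->] := rot_trans i j b'; exists l.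
  have one : region_rank (subdivided_join g x y) [:: nseq a w ++ [:: nverts g]] 1.
    apply: (@RankOne _ _ (nverts g) w a) => //; last by rewrite perm_catC.
    by apply: live_new_vertex; rewrite // eq_sym.
  have zero : region_rank (subdivided_join g x y) [:: [::] ++ [:: nverts g]] 0.
    by apply: (@region_rank_dead_join _ _ _ x [::]); auto.
  case: (rot_cons2_nseq xw yw eq_l) => -[_ _ -> ->]; last by exists 1, 0.
  by exists 0, 1.
Qed.

Lemma region_rank_moves g R k :
  region_rank g R k.+1 ->
  exists b x y i s t, [/\ R = [:: b], live g x y & rot i b = x :: s ++ y :: t].
Proof.
move eq_m: k.+1 => m rR; case: rR eq_m => {R m} //.
- move=> b u w [//|a] _ uw perm_b _.
  have u_b : u \in b by rewrite (perm_mem perm_b) mem_head.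
  have [i b' eq_b] := rot_to u_b.
  exists b, u, w, i, [::], (nseq a w); split=> //; rewrite eq_b; congr (_ :: _).
  have: perm_eq b' (nseq a.+1 w) by rewrite -(perm_cons u) -eq_b perm_rot.
  move=> perm_b'; have /all_pred1P-> : all (pred1 w) b'.
    by rewrite (perm_all _ perm_b') all_pred1_nseq.
  by rewrite (perm_size perm_b') size_nseq.
by move=> b i u v w a _ uv _ _ eq_b _; exists b, u, v, i, [::], (nseq a w).
Qed.

Lemma ranked_positive g rs k :
  ranked g rs k.+1 ->
  exists R k', [/\ R \in rs, all (gtn (nverts g)) (flatten R) & region_rank g R k'.+1].
Proof.
move eq_m: k.+1 => m rs_m; elim: rs_m k eq_m => // {rs m} R rs [|k1] l ltR rR _ IH k.
  by rewrite add0n => /IH[R' [k' [R'_rs ltR' rR']]]; exists R', k'; rewrite inE R'_rs orbT.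
by move=> _; exists R, k1; rewrite mem_head.
Qed.

(** * Positions with a determined number of remaining moves *)

(** Every play from here lasts exactly [k] moves. Keeping [plane_drawing] yields the planarity that
    [P4] demands of later graphs. *)
Definition settled (d : drawing) (k : nat) : Prop :=
  [/\ plane_drawing d, simple_triangle_free (graph d) &
      ranked (graph d) (regions d) k].

Lemma settled_move d d' k :
    settled d k -> BS2_move P4 d d' ->
  exists2 k', k = k'.+1 & settled d' k' /\ nverts (graph d') = (nverts (graph d)).+1.
Proof.
case=> plane Gd rk [mv [_ girth]]; have plane' := PlaneCrossed plane mv.
case: mv plane' girth => x y rs' n cv plane' /= girth.
case: cv plane' => {rs'} [i b s t R B C rest|i j b c s t R B rest] perm_rs perm_R;
  have [k1 [k2 [ltR rR rest_k2 ->]]] := ranked_consP (ranked_perm perm_rs rk).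
- move=> eq_b plane'.
  have ltb : all (gtn (nverts (graph d))) b.
    move: ltR; rewrite (perm_all _ (perm_flatten perm_R)) /= all_cat.
    by case/andP.
  have /and4P[ltx lts lty ltt] := all_rot_cons2 ltb eq_b.
  have xy := girth4_live ltx lty girth.
  have [eqBC [l1 [l2 [r1 r2 ->]]]] := region_rank_split Gd ltR rR xy perm_R eq_b.
  case: B C eqBC perm_R plane' => [|//] [|//] _ _ plane'.
  exists (l1 + (l2 + k2)); first by rewrite addSn addnA.
  split=> //; split=> //=; first exact: simple_triangle_free_join.
  have lt_new r : all (gtn (nverts (graph d))) r -> all (gtn n.+1) (flatten [:: r ++ [:: n]]).
    rewrite /= cats0 all_cat /= ltnSn !andbT; apply: sub_all => z; exact: ltnW.
  by do 2?[apply: RankedCons; [exact: lt_new| by [] |]]; apply: ranked_join.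
(* A merge needs two boundary components, whereas a ranked region has only one. *)
have sizeR : size R = 1 by case: rR.
by have := perm_size perm_R; rewrite sizeR.
Qed.

Lemma settled_moves d k : settled d k.+1 -> exists d', BS2_move P4 d d'.
Proof.
case=> plane Gd rk; have [R [k' [R_d ltR rR]]] := ranked_positive rk.
have [b [x [y [i [s [t [eq_R xy eq_b]]]]]]] := region_rank_moves rR.
subst R; rewrite /= cats0 in ltR.
have /and4P[ltx _ lty _] := all_rot_cons2 ltR eq_b.
have mv := AddCrossedCurve (CurveSplit [:: nverts (graph d)] (perm_to_rem R_d)
  (perm_refl [:: b] : perm_eq _ (b :: [::] ++ [::])) eq_b).
eexists; split; first exact: mv.
split; first by eexists; split; first exact: PlaneCrossed plane mv.
by apply: simple_triangle_free_girth; apply: simple_triangle_free_join.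
Qed.

(** * The opening: the first move and its reply *)

Lemma rot_nseq (T : eqType) n (z x : T) i s :
  rot i (nseq n z) = x :: s -> x = z /\ s = nseq n.-1 z.
Proof.
move=> eq_s; have : all (pred1 z) (x :: s).
  by rewrite -eq_s (eq_all_r (mem_rot i _)) all_pred1_nseq.
move=> /= /andP[/eqP-> /all_pred1P->]; split=> //; congr nseq.
by rewrite -(size_nseq n z) -(size_rot i (nseq n z)) eq_s.
Qed.

Lemma perm_eq_pair (T : eqType) (a b c d : T) (B : seq T) :
    perm_eq [:: a; b] [:: c, d & B] ->
  B = [::] /\ (c = a /\ d = b \/ c = b /\ d = a).
Proof.
move=> eq_ab; have := perm_size eq_ab; case: B eq_ab => // eq_ab _; split=> //.
have [eq_ca|neq_ca] := eqVneq c a.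
  left; subst c; move: eq_ab; rewrite perm_cons.
  by case/perm_eq_singleton.
right; have := perm_mem eq_ab c; rewrite !inE eqxx (negPf neq_ca) /= => /eqP eq_cb.
subst c; split=> //; move: eq_ab; rewrite -(perm_rot 1) /= perm_cons.
by case/perm_eq_singleton.
Qed.

Lemma plane_BS2_start p q : plane_drawing (BS2_start p q).
Proof.
pose d0 := Drawing (Multigraph 0 [::]) [:: [::]].
pose d1 := Drawing (Multigraph 1 [::]) [:: [:: nseq p 0]].
have add1 : add_spot p d0 d1 by apply: (@AddSpot p d0 [::] [::]).
have add2 : add_spot q d1 (BS2_start p q).
  by apply: (@AddSpot q d1 [:: nseq p 0] [::]); apply: perm_refl.
exact: PlaneSpot (PlaneSpot PlaneEmpty add1) add2.
Qed.

(** On the merged boundary the two tips of vertex 2 separate the remaining tips of the spots. *)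
Definition after_first_move (x y p q : nat) : drawing :=
  Drawing (subdivided_join (Multigraph 2 [::]) x y)
          [:: [:: nseq p.-1 x ++ [:: 2] ++ nseq q.-1 y ++ [:: 2]]].

Lemma BS2_first_move p q d :
    BS2_move P4 (BS2_start p q) d ->
  exists x y p' q', [/\ x = 0 /\ y = 1 \/ x = 1 /\ y = 0,
    p' = p /\ q' = q \/ p' = q /\ q' = p & d = after_first_move x y p' q'].
Proof.
case=> mv [_ girth]; case: mv girth => x y rs' n cv /= girth.
case: cv => {rs'} [i b s t R B C rest|i j b c s t R B rest] perm_rs.
  move/perm_eq_singleton: perm_rs => [-> _] perm_R eq_b.
  (* A split would join two tips of one boundary, hence a spot to itself, which the girth
     forbids. *)
  have [z lt_z b_z] : exists2 z, z < 2 & all (pred1 z) b.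
    have: b \in [:: nseq p 0; nseq q 1] by rewrite (perm_mem perm_R) mem_head.
    by rewrite !inE => /orP[]/eqP->; [exists 0|exists 1]; rewrite ?all_pred1_nseq.
  move: b_z; rewrite -(eq_all_r (mem_rot i b)) eq_b /= all_cat /=.
  case/and4P=> /eqP eq_x _ /eqP eq_y _; subst x y.
  by have := girth4_live (g := Multigraph 2 [::]) lt_z lt_z girth; rewrite /live eqxx.
move/perm_eq_singleton: perm_rs => [-> ->] perm_R eq_b eq_c.
have [-> bc] := perm_eq_pair perm_R.
case: bc => -[eb ec]; subst b c;
  have [-> ->] := rot_nseq eq_b; have [-> ->] := rot_nseq eq_c.
  by exists 0, 1, p, q; split; auto.
by exists 1, 0, q, p; split; auto.
Qed.

Lemma BS2_reply x y p q :
    (x = 0 /\ y = 1 \/ x = 1 /\ y = 0) -> plane_drawing (after_first_move x y p.+3 q.+3) ->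
  exists d, [/\ BS2_move P4 (after_first_move x y p.+3 q.+3) d,
                settled d 4 & nverts (graph d) = 4].
Proof.
move=> xy plane; set d0 := after_first_move x y p.+3 q.+3.
have neq_xy : x != y by case: xy => -[-> ->].
have ltx : x < 2 by case: xy => -[-> _].
have lty : y < 2 by case: xy => -[_ ->].
have G2 : simple_triangle_free (Multigraph 2 [::]) by [].
have G3 : simple_triangle_free (graph d0).
  by apply: simple_triangle_free_join; rewrite // /live neq_xy.
have xy3 : live (graph d0) x y by rewrite live_subdivided_join // /live neq_xy.
pose b := nseq p.+2 x ++ [:: 2] ++ nseq q.+2 y ++ [:: 2].
(* Joining the last tip of [x] to the last tip of [y] leaves [2 y^(q+1) 3] on one side and
   [2 x^(p+1) 3] on the other. *)
have eq_b : rot p.+1 b = x :: (2 :: nseq q.+1 y) ++ y :: (2 :: nseq p.+1 x).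
  have := rot_size_cat (nseq p.+1 x) (x :: 2 :: nseq q.+2 y ++ [:: 2]).
  rewrite size_nseq /b -[p.+2]addn1 -[q.+2]addn1 !nseqD -!catA => ->.
  by rewrite /= -!catA.
have mv := AddCrossedCurve (CurveSplit [:: nverts (graph d0)] (perm_refl (regions d0))
  (perm_refl [:: b] : perm_eq _ (b :: [::] ++ [::])) eq_b).
have rank2 u v : u = x /\ v = y \/ u = y /\ v = x -> forall n,
    region_rank (subdivided_join (graph d0) x y) [:: (2 :: nseq n.+1 u) ++ [:: 3]] 2.
  (* Vertices 3 and 2 have only the spots as neighbours; rotating by [n.+2] brings their tips
     together at the front. *)
  move=> uv n; apply: (@RankTwo _ _ n.+2 3 2 u n.+1) => //.
  - by rewrite /live /adj /= !joinsE; lia.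
  - by rewrite /adj /= !joinsE; case: uv => -[-> _]; rewrite !eqxx ?orbT.
  - by rewrite /adj /= !joinsE; case: uv => -[-> _]; rewrite !eqxx ?orbT.
  by have := rot_size_cat (2 :: nseq n.+1 u) [:: 3]; rewrite /= size_nseq.
have G4 := simple_triangle_free_join G3 (ltnW ltx) (ltnW lty) xy3.
eexists; split; [split; [exact: mv | split] | split | by []].
- by eexists; split; first exact: PlaneCrossed plane mv.
- exact: simple_triangle_free_girth.
- exact: PlaneCrossed plane mv.
- by [].
rewrite -[4]/(2 + (2 + 0)).
have tips u n : u < 2 -> all (gtn 4) (flatten [:: (2 :: nseq n u) ++ [:: 3]]).
  by move=> lt_u; rewrite /= cats0 all_cat all_nseq /=; lia.
by do 2![apply: RankedCons; [exact: tips | apply: rank2; auto | ]]; apply: RankedNil.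
Qed.

Theorem corollary6p2 (p q : nat) (hp : 3 <= p) (hq : 3 <= q) :
  second_player_has_winning_strategy (BS2_move P4) (BS2_start p q).
Proof.
(* After the reply there are 4 vertices and 4 moves left, and each move adds one vertex: hence the
   constant 8. An even [k] means that the second player moves last. *)
pose S d := d = BS2_start p q \/
  exists k, [/\ ~~ odd k, nverts (graph d) + k = 8 & settled d k].
have nv d d' : BS2_move P4 d d' -> nverts (graph d') = (nverts (graph d)).+1.
  by case=> -[].
apply: (@strategy_of_kernel _ _ S (fun d => 8 - nverts (graph d))); last by left.
- move=> d d' [->|[k [even_k nk Sd]]] mv.
    have [x [y [p' [q' [xy pq eq_d]]]]] := BS2_first_move mv; subst d'.
    have plane := PlaneCrossed (plane_BS2_start p q) mv.1.
    have [hp' hq'] : 3 <= p' /\ 3 <= q' by case: pq => -[-> ->].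
    case: p' q' hp' hq' {pq} => [|[|[|p']]] // [|[|[|q']]] // _ _ in mv plane *.
    have [z [mz Sz nz]] := BS2_reply xy plane.
    by exists z; split=> //; right; exists 4; rewrite nz.
  have [k' eq_k [Sd' nd']] := settled_move Sd mv; subst k.
  (* By parity the number of moves left is now odd, so a reply exists. *)
  case: k' => [//|k'] in even_k nk Sd Sd' *.
  have [z mz] := settled_moves Sd'.
  have [k2 [<-] [Sz nz]] := settled_move Sd' mz.
  exists z; split=> //; right; exists k'; split=> //; lia.
move=> d d' d'' [->|[k [_ nk Sd]]] mv mv' _; rewrite (nv _ _ mv') (nv _ _ mv) //.
(* A move was possible, so [k] is positive, [d] has fewer than 8 vertices and the truncated
   difference does decrease. *)
by have [k' eq_k _] := settled_move Sd mv; lia.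
Qed.
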